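(* Let $\mathbb{F}$ be a field which either has characteristic other than $2$, or is a finite field of characteristic $2$. Then every symplectic quandle over $\mathbb{F}$ is almost connected.
   Context: A quandle is a set $Q$ with a binary operation $\triangleright$ such that (i) $a\triangleright a=a$ for all $a$; (ii) for all $a,b$ there is a unique $c$ with $a=c\triangleright b$ (write $c=a\triangleright^{-1}b$; $\triangleright^{-1}$ is the dual operation); (iii) $(a\triangleright b)\triangleright c=(a\triangleright c)\triangleright(b\triangleright c)$ for all $a,b,c$. Symplectic quandle over a commutative ring with identity $R$: a free $R$-module $M$ of finite rank with an antisymmetric bilinear form $\langle\,,\rangle:M\times M\to R$ satisfying $\langle \mathbf{x},\mathbf{x}\rangle=0$ for all $\mathbf{x}\in M$, regarded as a quandle under $\mathbf{x}\triangleright\mathbf{y}=\mathbf{x}+\langle\mathbf{x},\mathbf{y}\rangle\mathbf{y}$; the dual operation is $\mathbf{x}\triangleright^{-1}\mathbf{y}=\mathbf{x}-\langle\mathbf{x},\mathbf{y}\rangle\mathbf{y}$. The form is not assumed non-degenerate. Here $R=\mathbb{F}$. The maximal trivial component of a quandle $Q$ is $D=\{x\in Q \mid x\triangleright y=x \text{ and } y\triangleright x=y \text{ for all } y\in Q\}$. Both $D$ and $Q\setminus D$ are allowed to be empty. A quandle $Q$ is the disjoint union of disjoint subquandles $Q_1,Q_2$ if $Q=Q_1\cup Q_2$ and $x\triangleright y=x$ whenever $x,y$ lie in different ones of $Q_1,Q_2$. A quandle is connected if every element can be obtained from every other element by a finite sequence of operations $\triangleright$ and $\triangleright^{-1}$,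 i.e. any $z$ is reached from any $x$ by successively applying maps of the form $u\mapsto u\triangleright y$ or $u\mapsto u\triangleright^{-1}y$ with $y$ in the quandle. A quandle is almost connected if it is the disjoint union of its maximal trivial component $D$ and a single connected subquandle (namely $Q\setminus D$). *)

(* Defs.v *)
From mathcomp Require Import all_boot all_order all_algebra.

Set Implicit Arguments.
Unset Strict Implicit.
Unset Printing Implicit Defensive.

Import GRing.Theory.
Local Open Scope ring_scope.

Declare Scope quandle_scope.
Delimit Scope quandle_scope with Q.
Local Open Scope quandle_scope.

(* The dual operation [qdual] is not extra data: [qdualP] says that
   [qdual a b] is the unique [c] with [a = qop c b] (see [qop_exists_unique]). *)
Record quandle := Quandle {
  qsort :> Type;
  qop : qsort -> qsort -> qsort;
  qdual : qsort -> qsort -> qsort;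
  qopxx : forall a, qop a a = a;
  qdualP : forall a b c, a = qop c b <-> c = qdual a b;
  qop_distr : forall a b c, qop (qop a b) c = qop (qop a c) (qop b c)
}.

Notation "x |> y" := (qop x y)
  (at level 40, left associativity) : quandle_scope.
Notation "x |>^-1 y" := (qdual x y)
  (at level 40, left associativity) : quandle_scope.

Lemma qop_exists_unique (Q : quandle) (a b : Q) : exists! c : Q, a = c |> b.
Proof.
exists (a |>^-1 b); split; first exact/qdualP.
by move=> c /qdualP.
Qed.

Section QuandleNotions.
Variable Q : quandle.

Definition subquandle (S : Q -> Prop) : Prop :=
  forall x y, S x -> S y -> S (x |> y) /\ S (x |>^-1 y).

(* For a subquandle [S] containing [x], all points visited lie in [S]: this is
   reachability in [S] regarded as a quandle of its own. *)
Inductive reachable (S : Q -> Prop) (x : Q) : Q -> Prop :=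
| reach_refl : reachable S x x
| reach_op u y : reachable S x u -> S y -> reachable S x (u |> y)
| reach_dual u y : reachable S x u -> S y -> reachable S x (u |>^-1 y).

(* The empty subquandle is connected. *)
Definition connected_subquandle (S : Q -> Prop) : Prop :=
  subquandle S /\ forall x z, S x -> S z -> reachable S x z.

Definition max_trivial_component (x : Q) : Prop :=
  forall y : Q, x |> y = x /\ y |> x = y.

Definition is_disjoint_union (S1 S2 : Q -> Prop) : Prop :=
  [/\ subquandle S1, subquandle S2,
      forall x, ~ (S1 x /\ S2 x),
      forall x, S1 x \/ S2 x
    & forall x y, S1 x -> S2 y -> x |> y = x /\ y |> x = y].

Definition almost_connected : Prop :=
  let D := max_trivial_component in
  let C := fun x => ~ D x in
  is_disjoint_union D C /\ connected_subquandle C.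

End QuandleNotions.

Definition alternating (R : comNzRingType) (M : vectType R)
    (form : {skew_symmetric M}) : Prop :=
  forall x : M, form x x = 0.

Section SymplecticQuandle.
Variables (R : comNzRingType) (M : vectType R) (form : {skew_symmetric M}).
Hypothesis form_alt : alternating form.

Definition sq_op (x y : M) : M := x + form x y *: y.
Definition sq_dual (x y : M) : M := x - form x y *: y.

Lemma sq_formDZl a u v w : form (u + a *: v) w = form u w + a * form v w.
Proof. by rewrite linearDl linearZl_LR. Qed.

Lemma sq_formDZr a u v w : form w (u + a *: v) = form w u + a * form w v.
Proof. by rewrite linearDr linearZr_LR. Qed.

Lemma sq_opxx x : sq_op x x = x.
Proof. by rewrite /sq_op form_alt scale0r addr0. Qed.

Lemma sq_dualP a b c : a = sq_op c b <-> c = sq_dual a b.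
Proof.
rewrite /sq_op /sq_dual; split=> ->.
  by rewrite sq_formDZl form_alt mulr0 addr0 addrK.
by rewrite -scaleNr sq_formDZl form_alt mulr0 addr0 scaleNr subrK.
Qed.

Lemma sq_op_distr a b c :
  sq_op (sq_op a b) c = sq_op (sq_op a c) (sq_op b c).
Proof.
have skew u v : form u v = - form v u.
  by rewrite hermitian_subproof expr1 mulN1r.
have isom : form (a + form a c *: c) (b + form b c *: c) = form a b.
  rewrite !(sq_formDZl, sq_formDZr) form_alt (skew c b) mulr0 addr0 mulrN.
  by rewrite [form b c * _]mulrC addrK.
rewrite /sq_op isom sq_formDZl scalerDl scalerDr !scalerA.
by rewrite -!addrA; congr (_ + _); rewrite addrCA.
Qed.

Definition symplectic_quandle : quandle :=
  Quandle sq_opxx sq_dualP sq_op_distr.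

End SymplecticQuandle.

(* Main.v *)
(** The maximal trivial component is the radical of the form.  Since
    [x |> c y = x + c^2 <x,y> y] and dually [x |>^-1 c y = x - c^2 <x,y> y],
    while [<x + t y, y> = <x, y>], one reaches [x + (a^2 - b^2) <x,y> y] from [x].
    Under the hypothesis on the field every scalar is a difference of two
    squares, so that if [<x,z> <> 0] then taking [y = z - x] gives a path from
    [x] to [z].  If [<x,z> = 0], go through some [w] orthogonal to neither. *)
Require Import Defs.
From mathcomp Require Import all_boot all_order all_algebra.
From mathcomp Require Import ring.
Import GRing.Theory.
Local Open Scope ring_scope.

Lemma sqr_diff_of_pchar_neq2 (F : fieldType) (t : F) :
  2%N \notin [pchar F] -> exists a b : F, t = a ^+ 2 - b ^+ 2.
Proof.
rewrite inE /= => two_neq0; exists ((t + 1) / 2%:R), ((t - 1) / 2%:R).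
by field; rewrite two_neq0.
Qed.

(** Squaring is the Frobenius map, hence injective; an injective self-map of a finite set is onto.
    Concretely, the list of squares is duplicate-free, contained in [s] and as long as [s]. *)
Lemma sqr_of_finite_pchar2 (F : fieldType) (s : seq F) (t : F) :
  2%N \in [pchar F] -> Finite.axiom s -> exists a : F, t = a ^+ 2.
Proof.
move=> char2 enum_s.
have mem_s x : x \in s by rewrite -has_pred1 has_count enum_s.
have uniq_s : uniq s by apply: count_mem_uniq => x; rewrite enum_s mem_s.
have sqr_inj : injective (fun x : F => x ^+ 2).
  exact: (fmorph_inj (pFrobenius_aut char2)).
have uniq_sqr : uniq [seq x ^+ 2 | x <- s] by rewrite map_inj_uniq.
have sub_s : {subset [seq x ^+ 2 | x <- s] <= s} by move=> x _; apply: mem_s.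
have le_size : (size s <= size [seq x ^+ 2 | x <- s])%N by rewrite size_map.
have [_ eq_s] := uniq_min_size uniq_sqr sub_s le_size.
by have /mapP[a _ ->] : t \in [seq x ^+ 2 | x <- s]; [rewrite eq_s | exists a].
Qed.

Section SymplecticOverField.
Variables (F : fieldType) (M : vectType F) (form : {skew_symmetric M}).
Hypothesis form_alt : alternating form.
Let Q := symplectic_quandle form_alt.
Let C (x : Q) : Prop := ~ max_trivial_component x.

Lemma formC (x y : M) : form x y = - form y x.
Proof. by rewrite hermitian_subproof expr1 mulN1r. Qed.

Lemma form_neq0C (x y : M) : (form x y != 0) = (form y x != 0).
Proof. by rewrite formC oppr_eq0. Qed.

Lemma max_trivial_componentE (x : Q) :
  max_trivial_component x <-> forall y : M, form x y = 0.
Proof.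
split=> [Dx y | x0 y]; last first.
  by rewrite /= /sq_op (formC y x) !x0 oppr0 !scale0r !addr0.
have [/(congr1 (fun z => z - x)) /= + _] := Dx y.
rewrite /sq_op addrC addKr subrr => /eqP; rewrite scaler_eq0.
by case/orP=> /eqP // ->; rewrite linear0r.
Qed.

(** By linearity it suffices to test [x] against a finite basis. This makes membership in the
    radical decidable, so that a negated universal statement yields an actual witness [y]. *)
Lemma radical_dec (x : M) :
  (forall y, form x y = 0) \/ exists y, form x y != 0.
Proof.
have [/forallP x0 | /forallPn[i xi]] :=
  boolP [forall i : 'I_(\dim {:M}), form x (vbasis {:M})`_i == 0]; last first.
  by right; exists (vbasis {:M})`_i.
left=> y; rewrite (coord_vbasis (memvf y)) linear_sumr big1 // => i _.
by rewrite linearZr_LR /= (eqP (x0 i)) mulr0.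
Qed.

Lemma nontrivialP (x : Q) : C x <-> exists y : M, form x y != 0.
Proof.
split=> [Cx | [y /eqP xy] /max_trivial_componentE x0]; last exact/xy/x0.
by have [x0|//] := radical_dec x; case: Cx; apply/max_trivial_componentE.
Qed.

Lemma reachable_trans (S : Q -> Prop) (x y z : Q) :
  reachable S x y -> reachable S y z -> reachable S x z.
Proof.
by move=> xy; elim=> // u v _ xu Sv; [apply: reach_op | apply: reach_dual].
Qed.

Lemma reachable_sqr (x y : M) (a : F) : form x y != 0 ->
  reachable C (x : Q) (x + (a ^+ 2 * form x y) *: y) /\
  reachable C (x : Q) (x - (a ^+ 2 * form x y) *: y).
Proof.
(* The acting element is [a *: y], which lies in [C] only for nonzero [a]; for [a = 0] the path is
   empty. *)
move=> xy; have [->|a0] := eqVneq a 0.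
  by rewrite expr0n mul0r scale0r subr0 addr0; split; apply: reach_refl.
have Cay : C (a *: y : M).
  by apply/nontrivialP; exists x; rewrite linearZl_LR mulf_neq0 // form_neq0C.
have := reach_op (reach_refl C (x : Q)) Cay.
have := reach_dual (reach_refl C (x : Q)) Cay.
by rewrite /= /sq_op /sq_dual linearZr_LR scalerA mulrAC.
Qed.

Hypothesis sqr_diff : forall t : F, exists a b : F, t = a ^+ 2 - b ^+ 2.

Lemma reachable_line (x y : M) (t : F) : form x y != 0 ->
  reachable C (x : Q) (x + t *: y).
Proof.
(* Each move along [y] carries a factor [form x y], so [t] is divided by it before being split into
   squares. *)
move=> xy; have [a [b tE]] := sqr_diff (t / form x y).
have [xu _] := reachable_sqr x y a xy.
set u := x + _ in xu.
have uy : form u y = form x y by rewrite sq_formDZl form_alt mulr0 addr0.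
have [|_ uv] := reachable_sqr u y b; first by rewrite uy.
suff -> : x + t *: y = u - (b ^+ 2 * form u y) *: y by apply: reachable_trans uv.
by rewrite uy -addrA -scalerBl -mulrBl -tE divfK.
Qed.

Lemma reachable_form_neq0 (x z : M) : form x z != 0 -> reachable C (x : Q) z.
Proof.
move=> xz; have := reachable_line x (z - x) 1.
by rewrite scale1r subrKC linearBr /= form_alt subr0; apply.
Qed.

(** If neither [a] nor [b] serves, then [a] is orthogonal to [z] and [b] to [x], so the cross terms
    vanish and [a + b] serves. *)
Lemma common_non_orthogonal (x z : M) :
  (exists y, form x y != 0) -> (exists y, form z y != 0) ->
  exists w, form x w != 0 /\ form z w != 0.
Proof.
move=> [a xa] [b zb].
have [za|za] := eqVneq (form z a) 0; last by exists a.
have [xb|xb] := eqVneq (form x b) 0; last by exists b.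
by exists (a + b); rewrite !linearDr /= za xb addr0 add0r.
Qed.

Lemma symplectic_quandle_almost_connected : almost_connected Q.
Proof.
have subC : subquandle C.
  (* If [form x y = 0], then [x] is fixed and [w] remains a witness; otherwise [y] is one, since
     moving along [y] preserves the pairing with [y]. *)
  move=> x y /nontrivialP[w xw] _; split; apply/nontrivialP;
    have [xy|xy] := eqVneq (form x y) 0.
  - by exists w; rewrite /= /sq_op xy scale0r addr0.
  - by exists y; rewrite /= /sq_op sq_formDZl form_alt mulr0 addr0.
  - by exists w; rewrite /= /sq_dual xy scale0r subr0.
  - by exists y; rewrite /= /sq_dual -scaleNr sq_formDZl form_alt mulr0 addr0.
split; split=> //.
- move=> x y Dx _; have /max_trivial_componentE x0 := Dx.
  by rewrite /= /sq_op /sq_dual x0 scale0r subr0 addr0.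
- by move=> x [Dx]; apply.
- move=> x; have [x0|xN0] := radical_dec x.
    by left; apply/max_trivial_componentE.
  by right; apply/nontrivialP.
- move=> x z /nontrivialP xN0 /nontrivialP zN0.
  (* Passing through [w] in every case avoids a split on [form x z = 0]. *)
  have [w [xw zw]] := common_non_orthogonal x z xN0 zN0.
  by apply: reachable_trans (reachable_form_neq0 w z _);
    [apply: reachable_form_neq0 | rewrite form_neq0C].
Qed.

End SymplecticOverField.

Theorem theorem9 (F : fieldType)
    (hF : 2%N \notin [pchar F] \/
          (2%N \in [pchar F] /\ exists s : seq F, Finite.axiom s))
    (M : vectType F) (form : {skew_symmetric M})
    (form_alt : alternating form) :
  almost_connected (symplectic_quandle form_alt).
Proof.
apply: symplectic_quandle_almost_connected => t.
case: hF => [charN2 | [char2 [s enum_s]]]; first exact: sqr_diff_of_pchar_neq2.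
have [a ->] := sqr_of_finite_pchar2 F s t char2 enum_s.
by exists a, 0; rewrite expr0n subr0.
Qed.
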